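(* Let $r,s$ be nonzero integers, let $m\ge 1$ be an integer, let $l\in\{0,1,\dots,m-1\}$, and put $y=\frac{r}{\sqrt{-s}}$. Then the ordinary generating function $$GSml(r,s;m,l;x):=\sum_{n=0}^{\infty}S\!\left(mn+l,\,y\right)x^n$$ satisfies, as formal power series in $x$, $$GSml(r,s;m,l;x)=\frac{1}{(\sqrt{-s})^{l}}\,GH01ml\!\left(r,s;m,l+1;\frac{x}{(\sqrt{-s})^{m}}\right)=\frac{S(l,y)-\bigl(S(l,y)\,R(m,y)-S(m+l,y)\bigr)x}{1-R(m,y)\,x+x^2}.$$
   Context: $\sqrt{\cdot}$ denotes the principal complex square root (so $\sqrt{-s}=i\sqrt{s}$ if $s>0$). The Chebyshev $S$-polynomials are defined by $S(0,x)=1$, $S(1,x)=x$, $S(n,x)=x\,S(n-1,x)-S(n-2,x)$ for $n\ge 2$, and are extended by $S(-1,x)=0$ and $S(n,x)=-S(-n-2,x)$ for $n\le -2$ (so $S(-2,x)=-1$). The $R$-polynomials (monic Chebyshev $T$-polynomials) are $R(n,x):=S(n,x)-S(n-2,x)$ for $n\ge 0$. The sequence $H01(r,s;n)$ is defined by $H01(r,s;0)=0$, $H01(r,s;1)=1$, $H01(r,s;n)=r\,H01(r,s;n-1)+s\,H01(r,s;n-2)$ for $n\ge 2$. For an integer $k\ge 0$, $GH01ml(r,s;m,k;x):=\sum_{n=0}^{\infty}H01(r,s;mn+k)\,x^n$. *)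

(* Defs.v *)
From HB Require Import structures.
From mathcomp Require Import all_boot all_order all_algebra.
From mathcomp Require Import boolp reals.
From mathcomp Require Import complex.

Set Implicit Arguments.
Unset Strict Implicit.
Unset Printing Implicit Defensive.

Import GRing.Theory.

Local Open Scope ring_scope.

(* Formal power series over K, given by their coefficient sequences. The      *)
(* commutative ring structure has the Cauchy product as multiplication; a     *)
(* series is a unit iff its constant term is.                                 *)
Record fps (K : Type) := Fps { fps_coef : nat -> K }.

Lemma fpsP (K : Type) (f g : fps K) :
  (forall n, fps_coef f n = fps_coef g n) -> f = g.
Proof. by case: f g => [f] [g] /= fg; congr Fps; apply/funext. Qed.

HB.instance Definition _ (K : Type) := gen_eqMixin (fps K).
HB.instance Definition _ (K : Type) := gen_choiceMixin (fps K).

Section FpsRing.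
Context {K : comUnitRingType}.
Implicit Types f g h : fps K.

Definition fps_zero : fps K := Fps (fun=> 0).
Definition fps_one : fps K := Fps (fun n => (n == 0%N)%:R).
Definition fps_opp f : fps K := Fps (fun n => - fps_coef f n).
Definition fps_add f g : fps K := Fps (fun n => fps_coef f n + fps_coef g n).
Definition fps_mul f g : fps K :=
  Fps (fun n => \sum_(i < n.+1) fps_coef f i * fps_coef g (n - i)%N).
Definition fps_scale (c : K) f : fps K := Fps (fun n => c * fps_coef f n).

Fact fps_addA : associative fps_add.
Proof. by move=> f g h; apply: fpsP => n /=; rewrite addrA. Qed.
Fact fps_addC : commutative fps_add.
Proof. by move=> f g; apply: fpsP => n /=; rewrite addrC. Qed.
Fact fps_add0 : left_id fps_zero fps_add.
Proof. by move=> f; apply: fpsP => n /=; rewrite add0r. Qed.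
Fact fps_addN : left_inverse fps_zero fps_opp fps_add.
Proof. by move=> f; apply: fpsP => n /=; rewrite addNr. Qed.

HB.instance Definition _ :=
  GRing.isZmodule.Build (fps K) fps_addA fps_addC fps_add0 fps_addN.

Let trunc n f : {poly K} := \poly_(i < n.+1) fps_coef f i.

Let coef_trunc n f i : (i <= n)%N -> (trunc n f)`_i = fps_coef f i.
Proof. by move=> lein; rewrite coef_poly ltnS lein. Qed.

Let mul_trunc N n f g : (n <= N)%N ->
  fps_coef (fps_mul f g) n = (trunc N f * trunc N g)`_n.
Proof.
move=> lenN; rewrite coefM; apply: eq_bigr => i _.
rewrite !coef_trunc //; first exact: leq_trans (leq_subr _ _) lenN.
by rewrite (leq_trans _ lenN) // -ltnS.
Qed.

Fact fps_mulC : commutative fps_mul.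
Proof.
by move=> f g; apply: fpsP => n; rewrite !(mul_trunc _ _ (leqnn n)) mulrC.
Qed.

Fact fps_mulA : associative fps_mul.
Proof.
move=> f g h; apply: fpsP => n.
transitivity (trunc n f * (trunc n g * trunc n h))`_n.
  rewrite coefM /=; apply: eq_bigr => i _.
  by rewrite -(mul_trunc _ _ (leq_subr i n)) (coef_trunc _ (leq_ord i)).
rewrite mulrA coefM /=; apply: eq_bigr => i _.
by rewrite -(mul_trunc _ _ (leq_ord i)) (coef_trunc _ (leq_subr i n)).
Qed.

Fact fps_mul1 : left_id fps_one fps_mul.
Proof.
move=> f; apply: fpsP => n /=; rewrite big_ord_recl /= mul1r subn0.
by rewrite big1 ?addr0 // => i _; rewrite mul0r.
Qed.

Fact fps_mulDl : left_distributive fps_mul fps_add.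
Proof.
move=> f g h; apply: fpsP => n /=; rewrite -big_split.
by apply: eq_bigr => i _; rewrite mulrDl.
Qed.

Fact fps_oner_neq0 : fps_one != fps_zero.
Proof.
apply/eqP => /(congr1 (fun f => fps_coef f 0)) /= /eqP.
by rewrite oner_eq0.
Qed.

HB.instance Definition _ :=
  GRing.Zmodule_isComNzRing.Build (fps K)
    fps_mulA fps_mulC fps_mul1 fps_mulDl fps_oner_neq0.

Fact fps_scaleA a b f : fps_scale a (fps_scale b f) = fps_scale (a * b) f.
Proof. by apply: fpsP => n /=; rewrite mulrA. Qed.
Fact fps_scale1 : left_id 1 fps_scale.
Proof. by move=> f; apply: fpsP => n /=; rewrite mul1r. Qed.
Fact fps_scaleDr : right_distributive fps_scale +%R.
Proof. by move=> a f g; apply: fpsP => n /=; rewrite mulrDr. Qed.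
Fact fps_scaleDl f : {morph fps_scale^~ f : a b / a + b}.
Proof. by move=> a b; apply: fpsP => n /=; rewrite mulrDl. Qed.

HB.instance Definition _ :=
  GRing.Zmodule_isLmodule.Build K (fps K)
    fps_scaleA fps_scale1 fps_scaleDr fps_scaleDl.

Definition fps_unit : {pred fps K} :=
  fun f => fps_coef f 0 \is a GRing.unit.

(* The first n coefficients b_0, ..., b_(n-1) of 1 / f, obtained by solving   *)
(* a_0 b_n + \sum_(i < n) a_(n-i) b_i = [n = 0], where a_i = fps_coef f i.    *)
Fixpoint fps_inv_seq f n : seq K :=
  if n isn't n'.+1 then [::] else
  let s := fps_inv_seq f n' in
  rcons s ((fps_coef f 0)^-1 *
    ((n' == 0%N)%:R - \sum_(i < n') fps_coef f (n' - i)%N * s`_i)).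

(* The identity on non-units, as usual for unitRingType. *)
Definition fps_inv f : fps K :=
  if fps_unit f then Fps (fun n => (fps_inv_seq f n.+1)`_n) else f.

Let size_inv_seq f n : size (fps_inv_seq f n) = n.
Proof. by elim: n => //= n IHn; rewrite size_rcons IHn. Qed.

Let nth_inv_seq f n i : (i < n)%N ->
  (fps_inv_seq f n)`_i = (fps_inv_seq f i.+1)`_i.
Proof.
elim: n => // n IHn; rewrite ltnS leq_eqVlt => /predU1P[-> // | ltin].
by rewrite [in LHS]/= nth_rcons size_inv_seq ltin IHn.
Qed.

Let inv_seqE f n : (fps_inv_seq f n.+1)`_n = (fps_coef f 0)^-1 *
  ((n == 0%N)%:R - \sum_(i < n) fps_coef f (n - i)%N * (fps_inv_seq f i.+1)`_i).
Proof.
rewrite [fps_inv_seq f n.+1]/= nth_rcons size_inv_seq ltnn eqxx.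
congr (_ * (_ - _)); apply: eq_bigr => i _.
by rewrite -(nth_inv_seq _ (ltn_ord i)).
Qed.

Fact fps_mulVx : {in fps_unit, left_inverse 1 fps_inv *%R}.
Proof.
move=> f uf; have {}uf : fps_unit f by [].
rewrite mulrC /fps_inv uf; apply: fpsP => n.
pose b i := (fps_inv_seq f i.+1)`_i.
change (\sum_(i < n.+1) fps_coef f i * b (n - i)%N = (n == 0%N)%:R).
have bE : b n = (fps_coef f 0)^-1 *
  ((n == 0%N)%:R - \sum_(i < n) fps_coef f (n - i)%N * b i) by exact: inv_seqE.
clearbody b; rewrite (reindex_inj rev_ord_inj) big_ord_recr /=.
rewrite !subSS subnn subn0 bE mulrA divrr // mul1r addrC.
under [X in _ + X = _]eq_bigr => i _.
  rewrite subSS subKn ?(ltnW (ltn_ord i)) //.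
  over.
by rewrite subrK.
Qed.

Fact fps_unitPl f g : g * f = 1 -> fps_unit f.
Proof.
move=> /(congr1 (fun h => fps_coef h 0)) /=.
rewrite big_ord1 /= => gf1; apply/unitrPr; exists (fps_coef g 0).
by rewrite mulrC.
Qed.

Fact fps_inv_out : {in [predC fps_unit], fps_inv =1 id}.
Proof. by move=> f nuf; rewrite /fps_inv ifN. Qed.

HB.instance Definition _ :=
  GRing.ComNzRing_hasMulInverse.Build (fps K)
    fps_mulVx fps_unitPl fps_inv_out.

(* The series f(c x). *)
Definition fps_dilate (c : K) f : fps K := Fps (fun n => fps_coef f n * c ^+ n).

Definition fps_of_poly (p : {poly K}) : fps K := Fps (fun n => p`_n).

End FpsRing.

(* S(n, x) for n >= 0, as a polynomial in x over K. *)
Fixpoint chebS_nat (K : comNzRingType) (n : nat) : {poly K} :=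
  match n with
  | 0 => 1
  | n1.+1 => if n1 is n2.+1 then 'X * chebS_nat K n1 - chebS_nat K n2 else 'X
  end.

(* Negz k is the integer - k - 1, hence - (Negz k) - 2 = k - 1. *)
Definition chebS (K : comNzRingType) (n : int) : {poly K} :=
  match n with
  | Posz k => chebS_nat K k
  | Negz 0 => 0
  | Negz k.+1 => - chebS_nat K k
  end.

Definition chebR (K : comNzRingType) (n : nat) : {poly K} :=
  chebS K n%:Z - chebS K (n%:Z - 2).

Fixpoint H01 (r s : int) (n : nat) : int :=
  match n with
  | 0 => 0
  | n1.+1 => if n1 is n2.+1 then r * H01 r s n1 + s * H01 r s n2 else 1
  end.

Definition GH01ml (R : realType) (r s : int) (m k : nat) : fps R[i] :=
  Fps (fun n => (H01 r s (m * n + k))%:~R).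

(* [sqrtc] is the principal square root: nonnegative real part, and           *)
(* sqrtc (- a) = 'i * sqrt a for real a > 0.                                  *)
Definition sqrtNs (R : realType) (s : int) : R[i] := sqrtc (- s%:~R).

Definition ycheb (R : realType) (r s : int) : R[i] := r%:~R / sqrtNs R s.

Definition GSml (R : realType) (r s : int) (m l : nat) : fps R[i] :=
  Fps (fun n => (chebS _ (m * n + l)%N%:Z).[ycheb R r s]).

(* Main.v *)
Require Import Defs.
From HB Require Import structures.
From mathcomp Require Import all_boot all_order all_algebra.
From mathcomp Require Import boolp reals.
From mathcomp Require Import complex.
From mathcomp Require Import ring zify.

(** Both sequences satisfy second-order recurrences, and [y q = r], [q^2 = - s]
    turn that of [S(n, y) q^n] into that of [H01(n + 1)].  For the rational
    form, any solution [u] of [u(k + 2) = y u(k + 1) - u(k)] satisfies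
    [u(p + j) + u(p - j) = R(j, y) u(p)] (the analogue of
    [sin(a + b) + sin(a - b) = 2 cos(b) sin(a)]); with [j = m] this is a
    recurrence along the progression [m n + l], whose characteristic polynomial
    gives the denominator. *)

Set Implicit Arguments.
Unset Strict Implicit.
Unset Printing Implicit Defensive.

Import GRing.Theory.

Local Open Scope ring_scope.

Section ChebyshevEvaluation.
Variables (K : comNzRingType) (y : K).

Lemma horner_chebSS n :
  (chebS K n.+2%:Z).[y] = y * (chebS K n.+1%:Z).[y] - (chebS K n%:Z).[y].
Proof. by rewrite /= hornerD hornerN mulrC hornerMX mulrC. Qed.

Lemma chebR0 : chebR K 0 = 2%:R.
Proof. by rewrite /chebR /= opprK. Qed.

Lemma chebR1 : chebR K 1 = 'X.
Proof. by rewrite /chebR /= subr0. Qed.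

(** The values [S(-1) = 0] and [S(-2) = -1] continue the recurrence of [S] backwards, so [R]
    inherits it from index 0 on. The cases that meet negative indices are computed apart. *)
Lemma chebRSS n : chebR K n.+2 = 'X * chebR K n.+1 - chebR K n.
Proof.
have E k : (k.+2%:Z - 2 = k%:Z)%R by lia.
case: n => [|[|n]]; first by rewrite chebR0 chebR1 /chebR E /=; ring.
  by rewrite chebR1 /chebR !E /=; ring.
by rewrite /chebR !E /=; ring.
Qed.

(** For fixed [p], both sides satisfy [w(j + 2) = y w(j + 1) - w(j)], as the recurrence of [u] reads
    the same in both directions, and both start with [2 u(p)], [y u(p)]. The bound on [j] keeps
    [p - j] from truncating. *)
Lemma chebR_shift (u : nat -> K) :
  (forall k, u k.+2 = y * u k.+1 - u k) ->
  forall j p, (j <= p)%N -> u (p + j)%N + u (p - j)%N = (chebR K j).[y] * u p.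
Proof.
move=> uSS j; elim/ltn_ind: j => -[|[|j]] IH p lejp.
- by rewrite addn0 subn0 chebR0 -polyC_natr hornerC mulr_natl mulr2n.
- case: p lejp => // p _; rewrite addn1 subn1 /= chebR1 hornerX uSS; ring.
have E0 := IH j (leqW (leqnn _)) p (ltnW (ltnW lejp)).
have E1 := IH j.+1 (leqnn _) p (ltnW lejp).
rewrite chebRSS hornerD hornerN mulrC ['X * _]mulrC hornerMX.
have Eu : u (p + j.+2)%N = y * u (p + j.+1)%N - u (p + j)%N.
  by rewrite !addnS uSS.
have Ed : u (p - j)%N = y * u (p - j.+1)%N - u (p - j.+2)%N.
  have -> : (p - j = (p - j.+2).+2)%N by lia.
  by have -> : (p - j.+1 = (p - j.+2).+1)%N by lia.
have -> : u (p - j.+2)%N = y * u (p - j.+1)%N - u (p - j)%N by rewrite Ed; ring.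
have -> : u p * ((chebR K j.+1).[y] * y - (chebR K j).[y]) =
  y * ((chebR K j.+1).[y] * u p) - (chebR K j).[y] * u p by ring.
by rewrite -E0 -E1 Eu; ring.
Qed.

(** The index shift aligns the initial values: [1, r] for [H01] from index 1, and [1, y q] on the
    right. *)
Lemma H01_chebS (r s : int) (q : K) :
  r%:~R = y * q -> s%:~R = - q ^+ 2 ->
  forall n, (H01 r s n.+1)%:~R = (chebS K n%:Z).[y] * q ^+ n.
Proof.
move=> Er Es; elim/ltn_ind => -[|[|n]] IH.
- by rewrite /= hornerC mulr1.
- by rewrite /= hornerX mulr1 mulr0 addr0 expr1.
have -> : H01 r s n.+3 = r * H01 r s n.+2 + s * H01 r s n.+1 by [].
rewrite intrD !intrM (IH n.+1) // (IH n (leqW (leqnn _))).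
by rewrite horner_chebSS Er Es !exprS; ring.
Qed.

End ChebyshevEvaluation.

(** After multiplication by the denominator, a unit since its constant term is 1, coefficients are
    compared: the recurrence kills those of degree at least 2, and [c] accounts for degree 1. *)
Lemma fps_ratio_quadratic (K : comUnitRingType) (b c : K) (f : fps K) :
  (forall n, fps_coef f n.+2 = b * fps_coef f n.+1 - fps_coef f n) ->
  fps_coef f 1 = b * fps_coef f 0 - c ->
  f = fps_of_poly ((fps_coef f 0)%:P - c%:P * 'X)
        / fps_of_poly (1 - b%:P * 'X + 'X^2).
Proof.
move=> fSS f1.
set D := fps_of_poly (1 - _ + _).
have DE n : fps_coef D n = (n == 0%N)%:R - b * (n == 1%N)%:R + (n == 2%N)%:R.
  by rewrite /= coefD coefB coefCM coef1 coefX coefXn.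
have uD : D \is a GRing.unit.
  change (fps_coef D 0 \is a GRing.unit).
  by rewrite DE /= mulr0 subr0 addr0 unitr1.
apply: (mulIr uD); rewrite divrK // mulrC; apply: fpsP => n.
transitivity (\sum_(i < n.+1) fps_coef D i * fps_coef f (n - i)%N) => //.
rewrite [RHS]/= coefB coefC coefCM coefX.
case: n => [|[|n]].
- by rewrite big_ord1 DE /=; ring.
- by rewrite !big_ord_recl big_ord0 !DE /= /bump /= subn0 subnn f1; ring.
(* Only three coefficients of [D] are nonzero, so the convolution reduces to the recurrence. *)
rewrite 3!big_ord_recl big1 => [|i _]; last by rewrite DE /=; ring.
by rewrite !DE /= /bump /= !addn0 subn0 subn1 subn2 /= fSS; ring.
Qed.

Theorem mainTheorem1 (R : realType) (r s : int) (m l : nat)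
    (hr : r != 0) (hs : s != 0) (hm : (1 <= m)%N) (hl : (l < m)%N) :
  let q : R[i] := sqrtNs R s in
  let y : R[i] := ycheb R r s in
  let Sy (n : nat) : R[i] := (chebS _ n%:Z).[y] in
  let Rm : R[i] := (chebR _ m).[y] in
  GSml R r s m l =
    (1 / q ^+ l) *: fps_dilate (1 / q ^+ m) (GH01ml R r s m l.+1)
  /\
  (1 / q ^+ l) *: fps_dilate (1 / q ^+ m) (GH01ml R r s m l.+1) =
    fps_of_poly ((Sy l)%:P - (Sy l * Rm - Sy (m + l)%N)%:P * 'X)
      / fps_of_poly (1 - Rm%:P * 'X + 'X^2).
Proof.
move=> q y Sy Rm.
have q2 : q ^+ 2 = - s%:~R by rewrite sqr_sqrtc.
have q0 : q != 0.
  have : q ^+ 2 != 0 by rewrite q2 oppr_eq0 intr_eq0.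
  by rewrite expf_eq0.
have qX k : q ^+ k != 0 by rewrite expf_neq0.
have Er : r%:~R = y * q by rewrite divfK.
have Es : s%:~R = - q ^+ 2 by rewrite q2 opprK.
have E : GSml R r s m l =
    (1 / q ^+ l) *: fps_dilate (1 / q ^+ m) (GH01ml R r s m l.+1).
  apply: fpsP => n /=.
  (* The factor [q ^+ (m * n + l)] cancels against the prefactor and the dilation. *)
  rewrite addnS (H01_chebS Er Es) exprD exprM !div1r exprVn.
  by field; rewrite expf_neq0 ?qX.
split=> //; rewrite -E.
have S0 : Sy l = fps_coef (GSml R r s m l) 0 by rewrite /= muln0.
(* Here [b] is [Rm], and [c] is exactly [b] times the coefficient 0 minus the coefficient
   [Sy (m + l)]. *)
rewrite {1}S0; apply: fps_ratio_quadratic => [n|]; last first.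
  change (Sy (m * 1 + l)%N =
    Rm * fps_coef (GSml R r s m l) 0 - (Sy l * Rm - Sy (m + l)%N)).
  by rewrite -S0 muln1; ring.
(* Centred at [m (n + 1) + l], a shift by [m] reaches the two neighbouring terms of the
   progression. *)
have := @chebR_shift _ y Sy (horner_chebSS y) m (m * n.+1 + l)%N.
rewrite mulnS -addnA leq_addr addKn => /(_ isT) H.
change (Sy (m * n.+2 + l)%N =
  Rm * Sy (m * n.+1 + l)%N - Sy (m * n + l)%N).
rewrite mulnS addnC addnA; apply/eqP; rewrite -subr_eq0 opprB; apply/eqP.
have -> : (l + m + m * n.+1 = m + (m * n + l) + m)%N by rewrite mulnS; lia.
have -> : (m * n.+1 + l = m + (m * n + l))%N by rewrite mulnS; lia.
by rewrite /Rm -H; ring.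
Qed.
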